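(* Let $G=\mathrm{Gal}(\bar{\mathbb{Q}}/\mathbb{Q})$, let $K\subset\bar{\mathbb{Q}}$ be a finite Galois extension of $\mathbb{Q}$ of degree $n$, $H=\mathrm{Gal}(\bar{\mathbb{Q}}/K)$, let $(\pi,W)$ be a Galois representation of $G$ and $\rho=\mathrm{Ind}_H^G(\pi|_H)$. The exact sequence $$1\to\rho(H)\to\rho(G)\xrightarrow{\gamma} G/H\to 1,\qquad \gamma(\rho(g))=gH,$$ is right split (that is, $\rho(G)\cong\rho(H)\rtimes G/H$ for some semidirect product group law) if and only if there exists a set of representatives $\{s_1,s_2,\dots,s_n\}$ of the $H$-cosets in $G$ such that $\{\rho(s_i)\}_i$ forms a multiplicatively closed subset of $\rho(G)$. (In fact, this subset is then a subgroup with the same group structure as $\{s_iH\}_i=G/H$.)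
   Context: Let $E$ be a number field, $\Lambda$ a prime of its ring of integers, and $E_\Lambda$ the completion. A Galois representation $(\pi,W)$ is a finite-dimensional $E_\Lambda$-vector space $W$ with a continuous homomorphism $\pi:G\to \mathrm{GL}(W)$. The induced representation $\rho=\mathrm{Ind}_H^G(\pi|_H)$ acts on $V=\{f:G\to W \mid f(hg)=\pi(h)f(g)\ \forall h\in H,\ g\in G\}$ by $(\rho(g)f)(x)=f(xg)$. The map $\gamma$ is a well-defined surjective homomorphism with kernel $\rho(H)$. A short exact sequence $1\to A\to B\xrightarrow{\gamma}C\to1$ is right split if there is a homomorphism $\iota:C\to B$ with $\gamma\circ\iota=\mathrm{id}_C$. *)

(* Defs.v *)
From HB Require Import structures.
From mathcomp Require Import all_boot all_order all_algebra all_field.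
From mathcomp Require Import generic_quotient ring_quotient.
From mathcomp Require Import boolp classical_sets functions reals.
From mathcomp Require Import topology normedtype.

Set Implicit Arguments.
Unset Strict Implicit.
Unset Printing Implicit Defensive.

Import Order.TTheory GRing.Theory Num.Theory.
Local Open Scope classical_set_scope.
Local Open Scope ring_scope.

(* The library's quotient groups are restricted to finite groups. *)
Record normal_subgroup (G : groupType) := NormalSubgroup {
  nsub :> G -> Prop;
  nsub1 : nsub 1%g;
  nsubM : forall x y, nsub x -> nsub y -> nsub (x * y)%g;
  nsubV : forall x, nsub x -> nsub (x^-1)%g;
  nsubJ : forall x y, nsub x -> nsub (x ^ y)%g }.

Section QuotientGroup.
Local Open Scope group_scope.
Local Open Scope quotient_scope.
Variables (G : groupType) (H : normal_subgroup G).

Definition lcoset_rel : rel G := fun x y => `[< H (x^-1 * y) >].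

Lemma lcoset_relP : equiv_class_of lcoset_rel.
Proof.
split=> [x|x y|y x z]; rewrite /lcoset_rel.
- by apply/asboolP; rewrite mulVg; exact: nsub1.
- by apply/idP/idP => /asboolP /nsubV; rewrite invgM invgK => ?; apply/asboolP.
- move=> /asboolP hxy /asboolP hyz; apply/asboolP.
  by have := nsubM hxy hyz; rewrite -mulgA mulgA mulgA mulgK.
Qed.

Canonical lcoset_equiv := EquivRelPack lcoset_relP.

(* The elements are the cosets lcoset g = gH (see eq_lcoset). *)
Definition quotient_group := {eq_quot lcoset_equiv}.
HB.instance Definition _ := Choice.on quotient_group.
HB.instance Definition _ := EqQuotient.on quotient_group.

Definition lcoset (g : G) : quotient_group := \pi_quotient_group g.

Lemma eq_lcoset x y : lcoset x = lcoset y <-> H (x^-1 * y).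
Proof.
split=> [/eqP|h]; first by rewrite eqmodE => /asboolP.
by apply/eqP; rewrite eqmodE; apply/asboolP.
Qed.

Definition quot_mul (c d : quotient_group) := lcoset (repr c * repr d).
Definition quot_inv (c : quotient_group) := lcoset (repr c)^-1.

Lemma lcoset_repr c : lcoset (repr c) = c.
Proof. by rewrite /lcoset reprK. Qed.

Lemma lcosetM x y : lcoset (x * y) = quot_mul (lcoset x) (lcoset y).
Proof.
apply/eq_lcoset; rewrite invgM.
set x' := repr _; set y' := repr _.
have /eq_lcoset hx : lcoset x = lcoset x' by rewrite lcoset_repr.
have /eq_lcoset hy : lcoset y = lcoset y' by rewrite lcoset_repr.
have := nsubM (nsubJ y hx) hy; rewrite /conjg.
by rewrite !mulgA mulgK.
Qed.

Lemma lcosetV x : lcoset x^-1 = quot_inv (lcoset x).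
Proof.
apply/eq_lcoset; rewrite invgK; set x' := repr _.
have /eq_lcoset hx : lcoset x' = lcoset x by rewrite lcoset_repr.
by have := nsubJ x'^-1 hx; rewrite /conjg invgK !mulgA mulgV mul1g.
Qed.

Lemma quot_mulA : associative quot_mul.
Proof.
move=> a b c; rewrite -(lcoset_repr a) -(lcoset_repr b) -(lcoset_repr c).
by rewrite -!lcosetM mulgA.
Qed.

Lemma quot_mul1 : left_id (lcoset 1) quot_mul.
Proof. by move=> a; rewrite -(lcoset_repr a) -lcosetM mul1g. Qed.

Lemma quot_mulr1 : right_id (lcoset 1) quot_mul.
Proof. by move=> a; rewrite -(lcoset_repr a) -lcosetM mulg1. Qed.

Lemma quot_mulV : left_inverse (lcoset 1) quot_inv quot_mul.
Proof.
by move=> a; rewrite -(lcoset_repr a) -lcosetV -lcosetM mulVg.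
Qed.

Lemma quot_mulrV : right_inverse (lcoset 1) quot_inv quot_mul.
Proof.
by move=> a; rewrite -(lcoset_repr a) -lcosetV -lcosetM mulgV.
Qed.

HB.instance Definition _ := isGroup.Build quotient_group
  quot_mulA quot_mul1 quot_mulr1 quot_mulV quot_mulrV.

End QuotientGroup.

Section MorphismTheory.
Local Open Scope group_scope.
Variables (G B : groupType) (f : {multiplicative G -> B}).

Lemma morph1 : f 1 = 1.
Proof. by apply: (@mulgI _ (f 1)); rewrite -gmulfM !mulg1. Qed.

Lemma morphF x y : f (x / y) = f x / f y.
Proof. by apply: (@mulIg _ (f y)); rewrite -gmulfM !mulgVK. Qed.

End MorphismTheory.

Section ImageSubgroup.
Local Open Scope group_scope.
Variables (G B : groupType) (f : {multiplicative G -> B}) (H : normal_subgroup G).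

Definition im_pred : {pred B} := fun y => `[< exists2 x, H x & y = f x >].

Lemma im_pred_closed : group_closed im_pred.
Proof.
split=> [|_ _ /asboolP[x Hx ->] /asboolP[y Hy ->]].
  by apply/asboolP; exists 1; [exact: nsub1 | rewrite morph1].
apply/asboolP; exists (x / y); last by rewrite morphF.
by apply: nsubM => //; apply: nsubV.
Qed.

Record im_group := ImGroup { im_val : B; _ : im_val \in im_pred }.
HB.instance Definition _ := [isSub for im_val].
HB.instance Definition _ := [Choice of im_group by <:].
HB.instance Definition _ :=
  SubChoice_isSubGroup.Build B im_pred im_group im_pred_closed.

End ImageSubgroup.

Definition whole_group (G : groupType) : normal_subgroup G :=
  @NormalSubgroup G (fun=> True) I (fun _ _ _ _ => I) (fun _ _ => I)
    (fun _ _ _ => I).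

Section GeneralLinearGroup.
Variables (K : fieldType) (V : lmodType K).

(* The inverse is determined by the map (glP). *)
Record GL := MkGL {
  gl_fun :> V -> V;
  gl_inv : V -> V;
  gl_linear : linear gl_fun;
  gl_funK : cancel gl_fun gl_inv;
  gl_invK : cancel gl_inv gl_fun }.

Lemma glP (a b : GL) : gl_fun a =1 gl_fun b -> a = b.
Proof.
move=> /funext; case: a b => [f f' lf fK f'K] [g g' lg gK g'K] /= fg.
subst g; have E : f' = g' by apply/funext => x; rewrite -{1}[x]g'K fK.
by subst g'; congr MkGL; exact: Prop_irrelevance.
Qed.

HB.instance Definition _ := gen_eqMixin GL.
HB.instance Definition _ := gen_choiceMixin GL.

Definition gl_one : GL := @MkGL idfun idfun
  (fun _ _ _ => erefl) (fun=> erefl) (fun=> erefl).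

Lemma gl_comp_linear (a b : GL) : linear (a \o b).
Proof. by move=> c u v /=; rewrite !gl_linear. Qed.

Lemma gl_inv_linear (a : GL) : linear (gl_inv a).
Proof.
move=> c u v; rewrite -{1}[u](gl_invK a) -{1}[v](gl_invK a) -gl_linear.
by rewrite gl_funK.
Qed.

Definition gl_mul (a b : GL) : GL := MkGL (gl_comp_linear a b)
  (can_comp (gl_funK a) (gl_funK b)) (can_comp (gl_invK b) (gl_invK a)).

Definition gl_opp (a : GL) : GL :=
  MkGL (gl_inv_linear a) (gl_invK a) (gl_funK a).

Lemma gl_mulA : associative gl_mul. Proof. by move=> a b c; apply: glP. Qed.
Lemma gl_mul1 : left_id gl_one gl_mul. Proof. by move=> a; apply: glP. Qed.
Lemma gl_mulr1 : right_id gl_one gl_mul. Proof. by move=> a; apply: glP. Qed.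
Lemma gl_mulV : left_inverse gl_one gl_opp gl_mul.
Proof. by move=> a; apply: glP => x /=; rewrite gl_funK. Qed.
Lemma gl_mulrV : right_inverse gl_one gl_opp gl_mul.
Proof. by move=> a; apply: glP => x /=; rewrite gl_invK. Qed.

HB.instance Definition _ :=
  isGroup.Build GL gl_mulA gl_mul1 gl_mulr1 gl_mulV gl_mulrV.

End GeneralLinearGroup.

Section Induction.
Variables (G : groupType) (H : normal_subgroup G) (K : fieldType).
Variables (W : lmodType K) (p : {multiplicative G -> GL W}).

(* Only the values of p on H are used: this is the space of Ind (p|_H). *)
Definition ind_pred : {pred (G -> W)} :=
  fun f => `[< forall h g, H h -> f (h * g)%g = p h (f g) >].

Lemma ind_pred_closed : submod_closed ind_pred.
Proof.
split=> [|a u v /asboolP hu /asboolP hv]; apply/asboolP => h g Hh.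
  have := gl_linear (p h) (-1) 0 0.
  by rewrite scaleN1r addNr => ->; rewrite scaleN1r addNr.
change (a *: u (h * g)%g + v (h * g)%g = p h (a *: u g + v g)).
by rewrite gl_linear hu // hv.
Qed.

Record ind_space := IndSpace { ind_fun :> G -> W; _ : ind_fun \in ind_pred }.
HB.instance Definition _ := [isSub for ind_fun].
HB.instance Definition _ := [Choice of ind_space by <:].
HB.instance Definition _ := GRing.SubChoice_isSubLmodule.Build K (G -> W)
  ind_pred ind_space ind_pred_closed.

Lemma ind_spaceP (f f' : ind_space) : ind_fun f =1 ind_fun f' -> f = f'.
Proof. by move=> /funext E; apply: val_inj. Qed.

Lemma ind_funE (f : ind_space) h g : H h -> f (h * g)%g = p h (f g).
Proof. by case: f => f /= /asboolP; apply. Qed.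

Lemma ind_act_subproof (g : G) (f : ind_space) :
  (fun x => f (x * g)%g) \in ind_pred.
Proof. by apply/asboolP => h x Hh; rewrite -mulgA; exact: ind_funE. Qed.

Definition ind_act (g : G) (f : ind_space) : ind_space :=
  IndSpace (ind_act_subproof g f).

Lemma ind_act_linear g : linear (ind_act g).
Proof. by move=> a u v; apply: ind_spaceP. Qed.

Lemma ind_actK g : cancel (ind_act g) (ind_act g^-1%g).
Proof. by move=> f; apply: ind_spaceP => x /=; rewrite mulgVK. Qed.

Lemma ind_actVK g : cancel (ind_act g^-1%g) (ind_act g).
Proof. by move=> f; apply: ind_spaceP => x /=; rewrite mulgK. Qed.

Definition ind_gl (g : G) : GL ind_space :=
  MkGL (ind_act_linear g) (ind_actK g) (ind_actVK g).

Lemma ind_glM : {morph ind_gl : x y / (x * y)%g}.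
Proof. by move=> x y; apply: glP => f; apply: ind_spaceP => g /=; rewrite mulgA. Qed.

HB.instance Definition _ := isMultiplicative.Build G (GL ind_space) ind_gl ind_glM.

Definition Ind : {multiplicative G -> GL ind_space} := ind_gl.

End Induction.


(* algC is an algebraic closure of Q and each of its ring endomorphisms is an
   automorphism (algC_autK, algC_invautK), so this is Gal(Qbar/Q). *)
Definition galQ := {rmorphism algC -> algC}.

Lemma galQP (s t : galQ) : s =1 t -> s = t.
Proof.
case: s t => [f [[cf] [df]]] [g [[cg] [dg]]] /= /funext fg; subst g.
by rewrite (Prop_irrelevance cf cg) (Prop_irrelevance df dg).
Qed.

HB.instance Definition _ := gen_eqMixin galQ.
HB.instance Definition _ := gen_choiceMixin galQ.

Definition galQ_one : galQ := idfun.
Definition galQ_mul (s t : galQ) : galQ := s \o t.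
Definition galQ_inv (s : galQ) : galQ := algC_invaut s.

Lemma galQ_mulA : associative galQ_mul.
Proof. by move=> s t u; apply: galQP. Qed.
Lemma galQ_mul1 : left_id galQ_one galQ_mul.
Proof. by move=> s; apply: galQP. Qed.
Lemma galQ_mulr1 : right_id galQ_one galQ_mul.
Proof. by move=> s; apply: galQP. Qed.
Lemma galQ_mulV : left_inverse galQ_one galQ_inv galQ_mul.
Proof. by move=> s; apply: galQP => x /=; rewrite algC_autK. Qed.
Lemma galQ_mulrV : right_inverse galQ_one galQ_inv galQ_mul.
Proof. by move=> s; apply: galQP => x /=; rewrite algC_invautK. Qed.

HB.instance Definition _ :=
  isGroup.Build galQ galQ_mulA galQ_mul1 galQ_mulr1 galQ_mulV galQ_mulrV.

(* Krull topology: as S runs through the finite subsets of Qbar, the sets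
   krull_ball s S are the cosets s Gal(Qbar/Q(S)), and every number field in
   Qbar is some Q(S). *)
Definition krull_ball (s : galQ) (S : seq algC) : set galQ :=
  [set t : galQ | {in S, t =1 s}].

HB.instance Definition _ := hasNbhs.Build galQ
  (fun s => [set A | exists S : seq algC, krull_ball s S `<=` A]).

Lemma krull_filter (s : galQ) : ProperFilter (nbhs s).
Proof.
split=> [[S /(_ s)]|]; first by apply.
split=> [|A B [S SA] [T TB]|A B AB [S SA]]; first by exists [::].
- exists (S ++ T) => t tST; split; [apply: SA | apply: TB] => x xS;
  by apply: tST; rewrite mem_cat xS ?orbT.
- by exists S; apply: subset_trans AB.
Qed.

Lemma krull_singleton (s : galQ) (A : set galQ) : nbhs s A -> A s.
Proof. by case=> S; apply. Qed.

Lemma krull_nbhs (s : galQ) (A : set galQ) : nbhs s A -> nbhs s (nbhs^~ A).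
Proof.
case=> S SA; exists S => t tS; exists S => u uS; apply: SA => x xS.
by rewrite uS // tS.
Qed.

HB.instance Definition _ := Nbhs_isNbhsTopological.Build galQ
  krull_filter krull_singleton krull_nbhs.

Section GaloisSubgroup.
Variables (K : splittingFieldType rat) (i : {rmorphism K -> algC}).

Lemma galQ_stable (s : galQ) (x : K) : exists y, s (i x) = i y.
Proof.
have /polyOver1P[q pq] := minPolyOver 1 x.
have [r /eqP pr] := splitting_field_normal 1%AS x.
have rq (f : {rmorphism K -> algC}) : map_poly f (minPoly 1 x) = map_poly ratr q.
  rewrite pq -map_poly_comp; apply: eq_map_poly => a /=.
  exact: (fmorph_eq_rat (f \o in_alg K)).
have rr (f : {rmorphism K -> algC}) : root (map_poly f (minPoly 1 x)) (f x).
  by rewrite fmorph_root root_minPoly.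
have := rr (s \o i); rewrite rq -(rq i) pr rmorph_prod /=.
under eq_bigr => y _ do rewrite map_polyXsubC.
rewrite -(big_map i xpredT (fun z => 'X - z%:P)) root_prod_XsubC.
by case/mapP => y _ ->; exists y.
Qed.

Definition galQ_fix (s : galQ) : Prop := forall x, s (i x) = i x.

Lemma galQ_fix1 : galQ_fix 1%g. Proof. by []. Qed.
Lemma galQ_fixM s t : galQ_fix s -> galQ_fix t -> galQ_fix (s * t)%g.
Proof. by move=> hs ht x; rewrite [LHS]/= ht hs. Qed.
Lemma galQ_fixV s : galQ_fix s -> galQ_fix (s^-1)%g.
Proof. by move=> hs x; rewrite -{1}hs; exact: algC_autK. Qed.
Lemma galQ_fixJ s t : galQ_fix s -> galQ_fix (s ^ t)%g.
Proof.
move=> hs x; rewrite /conjg; have [y ty] := galQ_stable t x.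
change (algC_invaut t (s (t (i x))) = i x).
by rewrite ty hs -ty algC_autK.
Qed.

(* Gal(Qbar/K), for K embedded in Qbar by i; it is normal since K is a
   splitting field over Q. *)
Definition absGal : normal_subgroup galQ :=
  NormalSubgroup galQ_fix1 galQ_fixM galQ_fixV galQ_fixJ.

End GaloisSubgroup.

Record absval (R : realType) (F : fieldType) := AbsVal {
  av :> F -> R;
  av_ge0 : forall x, 0 <= av x;
  av_eq0 : forall x, av x = 0 <-> x = 0;
  avM : forall x y, av (x * y) = av x * av y;
  avD : forall x y, av (x + y) <= av x + av y }.

(* F as a metric space for the distance v (x - y). *)
Definition abs_space (R : realType) (F : fieldType) (v : absval R F) : Type := F.

Section AbsSpace.
Variables (R : realType) (F : fieldType) (v : absval R F).

Definition abs_dist (x y : F) : R := v (x - y).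

Lemma abs_distxx x : abs_dist x x = 0.
Proof. by apply/av_eq0; rewrite subrr. Qed.

Lemma abs_dist_positivity x y : abs_dist x y = 0 -> x = y.
Proof. by move=> /av_eq0 /subr0_eq. Qed.

Lemma abs_dist_sym x y : abs_dist x y = abs_dist y x.
Proof.
have vN1 : v (-1) = 1.
  have v1 : v 1 = 1.
    have : v 1 * v 1 = v 1 by rewrite -avM mulr1.
    rewrite -{3}[v 1]mulr1 => /mulfI; apply.
    by apply/negP => /eqP /av_eq0 /eqP; rewrite oner_eq0.
  by apply/eqP; rewrite -(@eqrXn2 _ 2) ?av_ge0 ?ler01 // !expr2 -avM mulrNN !mulr1 v1.
by rewrite /abs_dist -opprB -mulN1r avM vN1 mul1r.
Qed.

Lemma abs_dist_triangle y x z : abs_dist x z <= abs_dist x y + abs_dist y z.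
Proof. by rewrite /abs_dist -(subrKA y x (- z)) ; exact: avD. Qed.

HB.instance Definition _ := Choice.copy (abs_space v) F.
HB.instance Definition _ := isMetric.Build R (abs_space v)
  abs_distxx abs_dist_positivity abs_dist_sym abs_dist_triangle.
HB.instance Definition _ := isPointed.Build (abs_space v) (0 : F).

Definition abs_complete : Prop :=
  forall A : set_system (abs_space v), ProperFilter A -> cauchy A -> cvg A.

End AbsSpace.

Section RingOfIntegers.
Variable E : fieldExtType rat.

Definition int_pred : {pred E} := fun x => `[< integralOver (intr : int -> E) x >].

Lemma int_pred_closed : subring_closed int_pred.
Proof.
split=> [|x y /asboolP hx /asboolP hy|x y /asboolP hx /asboolP hy];
  apply/asboolP; [exact: integral1 | exact: integral_sub | exact: integral_mul].
Qed.

Record ringInt := RingInt { ringInt_val :> E; _ : ringInt_val \in int_pred }.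
HB.instance Definition _ := [isSub for ringInt_val].
HB.instance Definition _ := [Choice of ringInt by <:].
HB.instance Definition _ :=
  GRing.SubChoice_isSubComNzRing.Build E int_pred ringInt int_pred_closed.

End RingOfIntegers.

Section AdicCompletion.

Fixpoint ideal_pow (A : comNzRingType) (I : {pred A}) (k : nat) : set A :=
  if k is k'.+1 then
    [set x | exists m (a b : 'I_m -> A),
      [/\ forall i, a i \in I, forall i, ideal_pow I k' (b i)
        & x = \sum_i a i * b i]]
  else setT.

(* adic_ord L x m : x <> 0 and ord_L(x) = m, where ord_L(a) = k means that a
   lies in L^k but not in L^(k+1) and ord_L(a / b) = ord_L(a) - ord_L(b). *)
Definition adic_ord (E : fieldExtType rat) (L : {pred ringInt E}) (x : E)
    (m : int) : Prop :=
  exists (a b : ringInt E) (k l : nat),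
    [/\ ideal_pow L k a /\ ~ ideal_pow L k.+1 a,
        ideal_pow L l b /\ ~ ideal_pow L l.+1 b,
        x = ringInt_val a / ringInt_val b & m = k%:Z - l%:Z].

(* E_L up to isomorphism: F is complete for an absolute value v that induces
   x |-> c ^ (- ord_L x) on the dense subfield E; the choice of c > 1 affects
   neither the field nor its topology. *)
Definition is_completion (R : realType) (E : fieldExtType rat)
    (L : {pred ringInt E}) (F : fieldType) (v : absval R F)
    (j : {rmorphism E -> F}) : Prop :=
  [/\ exists2 c : R, 1 < c & forall x m, adic_ord L x m -> v (j x) = c ^ (- m),
      @dense (abs_space v) (range j) & abs_complete v].

End AdicCompletion.

(* GL(W) carries the topology of its matrix entries, i.e. the coarsest one for
   which all matrix coefficients a |-> l (a w) are continuous. *)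
Definition continuous_rep (R : realType) (F : fieldType) (v : absval R F)
    (W : vectType F) (p : galQ -> GL W) : Prop :=
  forall (l : {scalar W}) (w : W),
    continuous ((fun g => l (p g w)) : galQ -> abs_space v).

Definition im_elt (G B : groupType) (f : {multiplicative G -> B}) (g : G) :
    im_group f (whole_group G) :=
  @ImGroup G B f (whole_group G) (f g) (asboolT (ex_intro2 _ _ g I erefl)).

Lemma im_incl_subproof (G B : groupType) (f : {multiplicative G -> B})
    (H : normal_subgroup G) (y : im_group f H) :
  im_val y \in im_pred f (whole_group G).
Proof. by case: y => y /= /asboolP[x _ ->]; apply/asboolP; exists x. Qed.

Definition im_incl (G B : groupType) (f : {multiplicative G -> B})
    (H : normal_subgroup G) (y : im_group f H) : im_group f (whole_group G) :=
  ImGroup (im_incl_subproof y).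

Definition right_split (B C : groupType) (gamma : B -> C) : Prop :=
  exists iota : {multiplicative C -> B}, cancel iota gamma.

Section SemidirectProduct.
Local Open Scope group_scope.
Variables (N C : groupType).

Record action_by_auts := ActionByAuts {
  aact :> C -> N -> N;
  aactM : forall c, {morph aact c : x y / x * y};
  aact1 : forall x, aact 1 x = x;
  aactD : forall c d x, aact (c * d) x = aact c (aact d x) }.

Definition semidirect (phi : action_by_auts) : Type := (N * C)%type.

Variable phi : action_by_auts.

Definition sd_one : semidirect phi := (1, 1).
Definition sd_mul (x y : semidirect phi) : semidirect phi :=
  (x.1 * phi x.2 y.1, x.2 * y.2).
Definition sd_inv (x : semidirect phi) : semidirect phi :=
  (phi x.2^-1 x.1^-1, x.2^-1).

Lemma aact_one c : phi c 1 = 1.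
Proof. by apply: (@mulgI _ (phi c 1)); rewrite -aactM !mulg1. Qed.

Lemma sd_mulA : associative sd_mul.
Proof. by move=> x y z; rewrite /sd_mul /= aactM aactD !mulgA. Qed.
Lemma sd_mul1 : left_id sd_one sd_mul.
Proof. by case=> a c; rewrite /sd_mul /= aact1 !mul1g. Qed.
Lemma sd_mulr1 : right_id sd_one sd_mul.
Proof. by case=> a c; rewrite /sd_mul /= aact_one !mulg1. Qed.
Lemma sd_mulV : left_inverse sd_one sd_inv sd_mul.
Proof. by case=> a c; rewrite /sd_mul /= -aactM !mulVg aact_one. Qed.
Lemma sd_mulrV : right_inverse sd_one sd_inv sd_mul.
Proof. by case=> a c; rewrite /sd_mul /= -aactD !mulgV aact1 mulgV. Qed.

HB.instance Definition _ := Choice.copy (semidirect phi) (N * C)%type.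
HB.instance Definition _ := isGroup.Build (semidirect phi)
  sd_mulA sd_mul1 sd_mulr1 sd_mulV sd_mulrV.

End SemidirectProduct.

(* B is a semidirect product N ><| C for some action of C on N, compatibly with
   the maps N -> B -> C. *)
Definition is_semidirect (N B C : groupType) (incl : N -> B) (gamma : B -> C)
    : Prop :=
  exists (phi : action_by_auts N C) (Phi : {multiplicative semidirect phi -> B}),
    [/\ bijective Phi, forall a, Phi (a, 1%g) = incl a
      & forall a c, gamma (Phi (a, c)) = c].

Definition coset_reps (G : groupType) (H : normal_subgroup G) (n : nat)
    (s : 'I_n -> G) : Prop :=
  forall c : quotient_group H, exists! k, lcoset H (s k) = c.

Definition im_reps (G B : groupType) (f : {multiplicative G -> B}) (n : nat)
    (s : 'I_n -> G) : {pred im_group f (whole_group G)} :=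
  fun y => `[< exists k, y = im_elt f (s k) >].

Arguments im_reps {G B} f {n} s.

Section Gamma.
Variables (G : groupType) (H : normal_subgroup G) (K : fieldType).
Variables (W : lmodType K) (p : {multiplicative G -> GL W}).

(* gamma (rho g) = gH; this determines gamma, as rho(G) = {rho g}. *)
Definition is_gamma
    (gamma : im_group (Ind H p) (whole_group G) -> quotient_group H) : Prop :=
  forall g, gamma (im_elt (Ind H p) g) = lcoset H g.

(* For W <> 0 the kernel of the induced representation lies in H, so that
   gamma exists (for W = 0 and H <> G it does not). *)
Lemma ind_ker (w : W) g : w != 0 -> Ind H p g = 1%g -> H g.
Proof.
move=> w0 g1; apply: contrapT => nHg.
pose f x := if `[< H x >] then p x w else 0.
have pf : f \in ind_pred H p.
  apply/asboolP => h x Hh; rewrite /f; case: asboolP => Hhx; case: asboolP => Hx.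
  - by rewrite gmulfM.
  - by case: Hx; have := nsubM (nsubV Hh) Hhx; rewrite mulKg.
  - by case: Hhx; exact: nsubM.
  - have := gl_linear (p h) (-1) 0 0.
    by rewrite scaleN1r addNr => ->; rewrite scaleN1r addNr.
have := congr1 (fun a : GL _ => ind_fun (a (IndSpace pf)) 1%g) g1.
rewrite /= mul1g /f; case: asboolP => // _; case: asboolP => [_|[]]; last exact: nsub1.
by rewrite morph1 /= => /esym/eqP; rewrite (negPf w0).
Qed.

Lemma gamma_exists (w : W) : w != 0 -> exists gamma, is_gamma gamma.
Proof.
move=> w0; pose pre (y : im_group (Ind H p) (whole_group G)) :=
  cid2 (asboolW (valP y)).
exists (fun y => lcoset H (s2val (pre y))) => g; apply/eq_lcoset.
apply: (ind_ker w0); rewrite gmulfM.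
have := s2valP' (pre (im_elt (Ind H p) g)); rewrite /= => E.
by rewrite [X in (_ * X)%g]E -gmulfM mulVg morph1.
Qed.

End Gamma.

(* Main.v *)
Require Import Defs.
From HB Require Import structures.
From mathcomp Require Import all_boot all_order all_algebra all_field.
From mathcomp Require Import boolp classical_sets reals.
Set Implicit Arguments.
Unset Strict Implicit.
Unset Printing Implicit Defensive.

Import GRing.Theory.
Local Open Scope ring_scope.

(** Everything except the number n of representatives is group theory, valid
    for any group morphism rho : G -> B whose kernel lies in a normal subgroup
    H; this is what the existence of gamma expresses.

    A section iota of gamma sends a coset c to some rho(g) with gH = c. Choosing
    such a g for each c gives representatives of the cosets whose images form
    iota(G/H), hence are closed under products ([reps_of_section]). Conversely,
    let the rho(s_k) be closed under products, where the s_k represent the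
    cosets. Since rho(s_k) rho(s_l) is some rho(s_m), and gamma shows that s_m
    represents the product of the cosets of s_k and s_l, the map
    s_k H |-> rho(s_k) is a morphism, hence a section of gamma
    ([section_of_reps]). Its image is the set of the rho(s_k), which is therefore
    a subgroup isomorphic to G/H. The semidirect decomposition is the usual one,
    with G/H acting on rho(H) by conjugation through iota ([right_splitP]).

    Arithmetic is needed only to index the cosets by 'I_n with n = [K : Q].
    Two elements of Gal(Qbar/Q) lie in the same coset of Gal(Qbar/K) exactly when
    they agree on K; every element of Gal(Qbar/Q) restricts to an element of
    Gal(K/Q) since K is normal, and every element of Gal(K/Q) extends to Qbar.
    So the cosets are in bijection with Gal(K/Q), which has n elements
    ([absGal_coset_reps]). *)

Lemma multiplicative_exists (G B : magmaType) (f : G -> B) :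
  {morph f : x y / (x * y)%g} -> exists F : {multiplicative G -> B}, F =1 f.
Proof.
move=> fM; pose F := HB.pack_for {multiplicative G -> B} f
  (isMultiplicative.Build G B f fM).
by exists F.
Qed.

Section SplitImage.
Local Open Scope group_scope.
Variables (G B : groupType) (H : normal_subgroup G) (rho : {multiplicative G -> B}).
Variable gamma : im_group rho (whole_group G) -> quotient_group H.
Hypothesis gammaE : forall g, gamma (im_elt rho g) = lcoset H g.

Lemma im_eltM x y : im_elt rho (x * y) = im_elt rho x * im_elt rho y.
Proof. by apply: val_inj; rewrite /= gmulfM. Qed.

Lemma im_elt_surj (y : im_group rho (whole_group G)) :
  exists g, y = im_elt rho g.
Proof.
case: y => y yP; have /asboolP[g _ Ey] := yP.
by exists g; apply: val_inj.
Qed.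

Lemma gammaM : {morph gamma : x y / x * y}.
Proof.
move=> x y; have [g ->] := im_elt_surj x; have [h ->] := im_elt_surj y.
by rewrite -im_eltM !gammaE lcosetM.
Qed.

(** [gamma_im_incl] and [gamma_ker] are the exactness of
    rho(H) -> rho(G) -> G/H in the middle. *)
Lemma gamma_im_incl (a : im_group rho H) : gamma (im_incl a) = 1.
Proof.
case: a => a aP; have /asboolP[h Hh Ea] := aP.
have -> : im_incl (ImGroup aP) = im_elt rho h by apply: val_inj.
by rewrite gammaE; apply/eq_lcoset; rewrite mulg1; exact: nsubV.
Qed.

Lemma gamma_ker y : gamma y = 1 -> val y \in im_pred rho H.
Proof.
have [g ->] := im_elt_surj y; rewrite gammaE => /eq_lcoset.
by rewrite mulg1 => /nsubV; rewrite invgK => Hg; apply/asboolP; exists g.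
Qed.

Lemma im_conj_subproof (y : im_group rho (whole_group G)) (a : im_group rho H) :
  val y * val a * (val y)^-1 \in im_pred rho H.
Proof.
have [g ->] := im_elt_surj y; case: a => a /= /asboolP[h Hh ->].
apply/asboolP; exists (h ^ g^-1); first exact: nsubJ.
by rewrite /conjg invgK -mulgA -/(h / g) gmulfM morphF mulgA.
Qed.

Definition im_conj y a : im_group rho H := ImGroup (im_conj_subproof y a).

(** A section iota turns conjugation by iota c into an action of G/H on rho(H),
    and (a, c) |-> a (iota c) is bijective because y (iota (gamma y))^-1 lies in
    the kernel rho(H) of gamma. *)
Lemma right_splitP :
  right_split gamma <-> is_semidirect (@im_incl _ _ rho H) gamma.
Proof.
split=> [[iota iotaK]|[phi [Phi [_ _ gammaPhi]]]]; last first.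
  have iotaM : {morph (fun c => Phi (1, c)) : c d / c * d}.
    move=> c d; rewrite -gmulfM; congr (Phi _).
    by change ((1, c * d) = (1 * phi c 1, c * d)); rewrite aact_one mulg1.
  have [iota iotaE] := multiplicative_exists iotaM.
  by exists iota => c; rewrite iotaE.
pose act c a := im_conj (iota c) a.
have actM c : {morph act c : x y / x * y}.
  by move=> x y; apply: val_inj; rewrite /= !mulgA mulgVK.
have act1 x : act 1 x = x.
  by apply: val_inj; rewrite /= morph1 /= mul1g invg1 mulg1.
have actD c d x : act (c * d) x = act c (act d x).
  by apply: val_inj; rewrite /= gmulfM /= invgM !mulgA.
pose phi := ActionByAuts actM act1 actD.
pose Phi0 (x : semidirect phi) := im_incl x.1 * iota x.2.
have Phi0M : {morph Phi0 : x y / x * y}.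
  move=> [a c] [b d]; apply: val_inj.
  by rewrite /= gmulfM /= !mulgA mulgVK.
have [Phi PhiE] := multiplicative_exists Phi0M.
have gammaPhi a c : gamma (Phi (a, c)) = c.
  by rewrite PhiE /Phi0 gammaM gamma_im_incl iotaK mul1g.
exists phi, Phi; split=> //; last first.
  by move=> a; rewrite PhiE /Phi0 /= morph1 mulg1.
have kerP y : val (y / iota (gamma y)) \in im_pred rho H.
  apply: gamma_ker; apply: (mulIg (gamma y)).
  by rewrite mul1g -[X in _ * X]iotaK -gammaM mulgVK.
exists (fun y => (ImGroup (kerP y), gamma y)) => [[a c]|y].
  congr (_, _); last exact: gammaPhi.
  apply: val_inj.
  by rewrite /= gammaPhi PhiE /= mulgK.
by rewrite PhiE; apply: val_inj; rewrite /= mulgVK.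
Qed.

Section Representatives.
Variables (n : nat) (s : 'I_n -> G).
Hypothesis sP : coset_reps H s.

(** Closure under products makes the section s_k H |-> rho(s_k) multiplicative:
    the index of a product in the image is read off by gamma. *)
Lemma section_of_reps : mulg_closed (im_reps rho s) ->
  exists f : {multiplicative quotient_group H -> im_group rho (whole_group G)},
    cancel f gamma /\ forall k, f (lcoset H (s k)) = im_elt rho (s k).
Proof.
have sE c : exists k, lcoset H (s k) = c by have [k [Ek _]] := sP c; exists k.
move=> sM; have [k kP] := choice sE.
have k_unique c l : lcoset H (s l) = c -> k c = l.
  by move=> El; have [m [_ mU]] := sP c; rewrite -(mU _ (kP c)) -(mU _ El).
have fM : {morph (fun c => im_elt rho (s (k c))) : c d / c * d}.
  move=> c d; have sk l : im_elt rho (s l) \in im_reps rho s.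
    by apply/asboolP; exists l.
  have /asboolP[l El] := sM _ _ (sk (k c)) (sk (k d)).
  rewrite El; congr (im_elt rho (s _)); apply: k_unique.
  by rewrite -gammaE -El gammaM !gammaE !kP.
have [f fE] := multiplicative_exists fM; exists f.
by split=> [c|l]; rewrite fE ?gammaE ?kP // (k_unique _ l).
Qed.

Lemma im_reps_group_closed : mulg_closed (im_reps rho s) ->
  group_closed (im_reps rho s).
Proof.
move=> /section_of_reps[f [_ fE]].
have repsP y : y \in im_reps rho s <-> exists c, y = f c.
  split=> [/asboolP[k ->]|[c ->]]; first by exists (lcoset H (s k)).
  by have [k [<- _]] := sP c; apply/asboolP; exists k.
split=> [|_ _ /repsP[c ->] /repsP[d ->]]; apply/repsP.
  by exists 1; rewrite morph1.
by exists (c / d); rewrite morphF.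
Qed.

(** Replacing each [s k] by a lift of the value of the section at its coset
    does not change the coset, because gamma (iota c) = c; the images of the
    new representatives then form the image of a morphism. *)
Lemma reps_of_section : right_split gamma ->
  exists2 t : 'I_n -> G, coset_reps H t & mulg_closed (im_reps rho t).
Proof.
case=> iota iotaK.
have [t tP] := choice (fun k => im_elt_surj (iota (lcoset H (s k)))).
have tE k : lcoset H (t k) = lcoset H (s k) by rewrite -gammaE -tP iotaK.
exists t => [c|_ _ /asboolP[k ->] /asboolP[l ->]].
  by have [k [Ek kU]] := sP c; exists k; split=> [|l]; rewrite tE // => /kU.
have [m [Em _]] := sP (lcoset H (s k) * lcoset H (s l)).
by apply/asboolP; exists m; rewrite -!tP Em gmulfM.
Qed.

End Representatives.

End SplitImage.

Section GaloisCosets.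
Variables (K : splittingFieldType rat) (i : {rmorphism K -> algC}).

Lemma eq_absGal_coset (s t : galQ) :
  lcoset (absGal i) s = lcoset (absGal i) t <-> forall x, s (i x) = t (i x).
Proof.
split=> [/eq_lcoset st x|st]; last first.
  by apply/eq_lcoset => x; rewrite [LHS]/= -st algC_autK.
by have /(congr1 s) := st x; rewrite [LHS]/= algC_invautK.
Qed.

Lemma galQ_extend (x : gal_of {:K}) : exists s : galQ, forall y, s (i y) = i (x y).
Proof.
by have [s sP] := extend_algC_subfield_aut i x; exists s => y; rewrite sP.
Qed.

(** Normality of K gives s (i K) in i K, so s induces a map on K; it is
    automatically Q-linear, and an injective endomorphism of a
    finite-dimensional space is onto. *)
Lemma galQ_restrict (s : galQ) :
  exists2 x : gal_of {:K}, x \in 'Gal({:K} / 1)%g & forall y, s (i y) = i (x y).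
Proof.
have [r rP] := choice (galQ_stable i s).
have rB : zmod_morphism r.
  by move=> x y; apply: (fmorph_inj i); rewrite -rP !rmorphB /= !rP.
have rM : monoid_morphism r.
  by split=> [|x y]; apply: (fmorph_inj i); rewrite -rP ?rmorph1 // !rmorphM /= !rP.
pose rR := HB.pack_for {rmorphism K -> K} r
  (GRing.isZmodMorphism.Build _ _ r rB) (GRing.isMonoidMorphism.Build _ _ r rM).
pose rL := HB.pack_for {linear K -> K} r rR
  (GRing.isScalable.Build _ _ _ _ r (fmorph_numZ rR)).
have lrM : monoid_morphism (linfun rL).
  by split=> [|x y]; rewrite !lfunE /= ?rM.1 ?rM.2.
have /kAut_to_gal[x galx xE] : kAut 1 {:K} (linfun rL).
  by rewrite kAutfE; apply/kHom_monoid_morphism.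
by exists x => // y; rewrite -xE ?memvf // lfunE rP.
Qed.

(** Restriction to K identifies the cosets with Gal(K/Q), whose order is the
    degree of K; the representatives are chosen extensions of its elements. *)
Lemma absGal_coset_reps : galois 1 {:K} ->
  exists s : 'I_(\dim {:K}) -> galQ, coset_reps (absGal i) s.
Proof.
move=> galK; have := galois_dim galK; rewrite dimv1 divn1 => ->.
have [nu nuP] := choice galQ_extend.
exists (fun k => nu (enum_val k)) => c; rewrite -(lcoset_repr c).
have [x galx xE] := galQ_restrict (repr c).
exists (enum_rank_in galx x); split.
  by apply/eq_absGal_coset => y; rewrite nuP enum_rankK_in // xE.
move=> k /eq_absGal_coset Ek; apply: enum_val_inj; rewrite enum_rankK_in //.
apply/eqP/gal_eqP => y _; apply: (fmorph_inj i).
by rewrite -xE -Ek nuP.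
Qed.

End GaloisCosets.

Theorem theorem3p7
    (R : realType) (E : fieldExtType rat) (L : prime_idealr (ringInt E))
    (L_neq0 : exists2 x, x \in L & x != 0)
    (EL : fieldType) (v : absval R EL) (j : {rmorphism E -> EL})
    (EL_completion : is_completion L v j)
    (K : splittingFieldType rat) (i : {rmorphism K -> algC})
    (galK : galois 1 {:K}) (n : nat) (dimK : \dim {:K} = n)
    (W : vectType EL) (pi : {multiplicative galQ -> GL W})
    (pi_continuous : continuous_rep v pi) :
  let H := absGal i in
  let rho := Ind H pi in
  forall (gamma : im_group rho (whole_group galQ) -> quotient_group H)
    (gammaE : is_gamma gamma),
  [/\ right_split gamma <->
        is_semidirect (@im_incl _ _ rho H) gamma,
      right_split gamma <->
        exists2 s : 'I_n -> galQ, coset_reps H s & mulg_closed (im_reps rho s)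
    & forall s : 'I_n -> galQ, coset_reps H s -> mulg_closed (im_reps rho s) ->
        group_closed (im_reps rho s) /\
        exists f : {multiplicative quotient_group H ->
                    im_group rho (whole_group galQ)},
          injective f /\ forall k, f (lcoset H (s k)) = im_elt rho (s k)].
Proof.
move=> H rho gamma gammaE; split.
- exact: right_splitP.
- split=> [|[s sP sM]].
    have [s sP] := absGal_coset_reps i galK; rewrite -dimK.
    exact: (reps_of_section gammaE sP).
  by have [f [fK _]] := section_of_reps gammaE sP sM; exists f.
- move=> s sP sM; split; first exact: (im_reps_group_closed gammaE sP sM).
  have [f [fK fE]] := section_of_reps gammaE sP sM.
  by exists f; split=> //; exact: can_inj fK.
Qed.
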